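(* Let $X\subset\mathbb{R}^d$ be a finite set, $\mathcal H=\mathbb{R}^X$ with the Euclidean inner product $\langle\cdot,\cdot\rangle$ and norm $\|\cdot\|$, and let $Q_1,\dots,Q_n:\mathcal H\to\mathcal H$ be deterministic linear quasi-interpolation operators, with multiscale approximation operators $M_j$, multiscale error operators $E_j$, and accumulated residual operators $\mathcal R_j=(I-Q_j)\cdots(I-Q_1)$. Let $f\in\mathcal H$ and let $Y=f+\varepsilon$, where $\varepsilon$ is a random element of $\mathcal H$ with $\mathbb{E}[\varepsilon]=0$. Let $\widetilde f_n=M_nY$. Then $$\mathbb{E}[\widetilde f_n]=M_nf,\qquad f-\mathbb{E}[\widetilde f_n]=E_nf=\mathcal R_nf .$$ Consequently, for every $x\in X$, $$\bigl(f(x)-\mathbb{E}[\widetilde f_n(x)]\bigr)^2=\bigl((\mathcal R_nf)(x)\bigr)^2 .$$ If, in addition, $\operatorname{Cov}(\varepsilon)=\sigma^2I$, then $$\operatorname{IBias}^2_n=\|\mathcal R_nf\|^2,\qquad \operatorname{IVar}_n=\sigma^2\operatorname{tr}(M_nM_n^* ),\qquad \operatorname{MISE}_n=\|\mathcal R_nf\|^2+\sigma^2\operatorname{tr}(M_nM_n^* ),$$ where $M_n^*$ is the adjoint of $M_n$ with respect to $\langle\cdot,\cdot\rangle$.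
   Context: The data sites $X$ and a nested hierarchy $X_1\subset\cdots\subset X_n=X$ are fixed; $\mathbb{E}$ is the expectation with respect to the noise $\varepsilon$ only. The level-$i$ quasi-interpolation operator $Q_i:\mathcal H\to\mathcal H$ restricts the values of a function on $X$ to $X_i$, forms the level-$i$ quasi-interpolant from them, and re-evaluates it on all of $X$; the only structural property assumed is that $Q_i$ is deterministic and linear. Multiscale recursion: $M_0=0$, $E_0=I$, and for $i=1,\dots,n$: $M_if=M_{i-1}f+Q_iE_{i-1}f$, $E_if=E_{i-1}f-Q_iE_{i-1}f$. Residual operators: $R_i=I-Q_i$, $\mathcal R_0=I$, $\mathcal R_j=R_jR_{j-1}\cdots R_1$. Integrated quantities are sums over the data sites (no normalization): $\operatorname{IBias}^2_n=\sum_{x\in X}(f(x)-\mathbb{E}[\widetilde f_n(x)])^2$, $\operatorname{IVar}_n=\sum_{x\in X}\mathbb{E}[(\widetilde f_n(x)-\mathbb{E}[\widetilde f_n(x)])^2]$, $\operatorname{MISE}_n=\sum_{x\in X}\mathbb{E}[(f(x)-\widetilde f_n(x))^2]$. *)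

(* Defs.v *)
From HB Require Import structures.
From mathcomp Require Import all_boot all_order all_algebra.
From mathcomp Require Import finmap.
From mathcomp Require Import all_classical all_reals all_analysis.

Set Implicit Arguments.
Unset Strict Implicit.
Unset Printing Implicit Defensive.

Import Order.TTheory GRing.Theory Num.Theory.
Local Open Scope ring_scope.

Section Operators.
Variables (R : realType) (dim : nat) (X : {fset 'rV[R]_dim}).
(* [R^o] is [R] seen as a vector space over itself, so that R^X is a
   [vectType R] and its linear operators form the type ['End(H)]. *)
Local Notation H := {ffun X -> R^o}.
Implicit Types (u v : H) (A : 'End(H)) (Q : nat -> 'End(H)).

Definition inner u v : R := \sum_(x : X) u x * v x.

Definition hnorm u : R := Num.sqrt (inner u u).

Definition delta (x : X) : H := [ffun y => (y == x)%:R].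

(* Column convention: column [j] holds the values of [A (delta x_j)]. *)
Definition opmx A : 'M[R]_#|{: X}| :=
  \matrix_(i, j) A (delta (enum_val j)) (enum_val i).

Definition optrace A : R := \tr (opmx A).

(* The value of the adjoint at [v] has coordinates
   [inner (delta x) (A^* v) = inner (A (delta x)) v]; see [inner_adjoint] and
   [adjoint_unique]. *)
Definition adjoint_fun A (v : H) : H := [ffun x => inner (A (delta x)) v].

Lemma adjoint_fun_linear A : linear (adjoint_fun A).
Proof.
move=> a u v; apply/ffunP => x; rewrite !ffunE /inner scaler_sumr -big_split /=.
apply: eq_bigr => y _; rewrite !ffunE mulrDr; congr (_ + _).
exact: mulrCA.
Qed.

HB.instance Definition _ A :=
  GRing.isLinear.Build R H H *:%R (adjoint_fun A) (adjoint_fun_linear A).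

Definition adjoint A : 'End(H) := linfun (adjoint_fun A).

Lemma inner_delta u x : inner (delta x) u = u x.
Proof.
rewrite /inner (bigD1 x) //= big1 => [|y yx].
  by rewrite ffunE eqxx mul1r addr0.
by rewrite ffunE (negPf yx) mul0r.
Qed.

Lemma delta_sum u : u = \sum_(x : X) (u x : R) *: delta x.
Proof.
apply/ffunP => y; rewrite sum_ffunE (bigD1 y) //= big1 => [|x xy].
  by rewrite !ffunE eqxx addr0; apply/esym/mulr1.
by rewrite !ffunE eq_sym (negPf xy) scaler0.
Qed.

Lemma inner_adjoint A u v : inner (A u) v = inner u (adjoint A v).
Proof.
rewrite {1}(delta_sum u) linear_sum /inner.
under eq_bigr do rewrite sum_ffunE mulr_suml.
rewrite exchange_big /=; apply: eq_bigr => x _.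
rewrite lfunE /= ffunE /inner mulr_sumr.
by apply: eq_bigr => y _; rewrite linearZ /= ffunE -mulrA.
Qed.

Lemma adjoint_unique A (B : 'End(H)) :
  (forall u v, inner (A u) v = inner u (B v)) -> B = adjoint A.
Proof.
move=> AB; apply/lfunP => v; apply/ffunP => x.
by have := AB (delta x) v; rewrite inner_adjoint !inner_delta.
Qed.

(* [multiscale Q j] is the pair [(M_j, E_j)]. Only the values [Q 1, ..., Q j]
   enter; [Q 0] is never used. *)
Fixpoint multiscale Q (j : nat) : 'End(H) * 'End(H) :=
  if j is i.+1 then
    let: (M, E) := multiscale Q i in
    (M + (Q i.+1 \o E)%VF, E - (Q i.+1 \o E)%VF)
  else (0, \1%VF).

Definition Mop Q j : 'End(H) := (multiscale Q j).1.

Definition Eop Q j : 'End(H) := (multiscale Q j).2.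

Definition resid Q (i : nat) : 'End(H) := \1%VF - Q i.

Fixpoint accresid Q (j : nat) : 'End(H) :=
  if j is i.+1 then (resid Q i.+1 \o accresid Q i)%VF else \1%VF.

End Operators.

Section Random.
Variables (R : realType) (dim : nat) (X : {fset 'rV[R]_dim}).
Variables (d : measure_display) (T : measurableType d) (P : probability T R).
Implicit Types Z : T -> {ffun X -> R^o}.

Definition coord Z (x : X) : T -> R := fun w => Z w x.

Definition random_element Z : Prop :=
  forall x, measurable_fun [set: T] (coord Z x).

Definition integrable_element Z : Prop :=
  forall x, P.-integrable [set: T] (EFin \o coord Z x).

(* Meaningful when [integrable_element Z] holds. *)
Definition mean Z : {ffun X -> R^o} := [ffun x => fine 'E_P[coord Z x]%E].

Definition has_cov_scalar Z (c : R) : Prop :=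
  forall x y : X,
    covariance P (coord Z x) (coord Z y) = (c * (x == y)%:R)%:E.

Definition IBias2 (f : {ffun X -> R^o}) Z : R :=
  \sum_(x : X) (f x - mean Z x) ^+ 2.

Definition IVar Z : \bar R :=
  (\sum_(x : X) 'E_P[fun w => ((coord Z x w - mean Z x) ^+ 2)%R])%E.

Definition MISE (f : {ffun X -> R^o}) Z : \bar R :=
  (\sum_(x : X) 'E_P[fun w => ((f x - coord Z x w) ^+ 2)%R])%E.

End Random.

(* Main.v *)
Require Import Defs.
From HB Require Import structures.
From mathcomp Require Import all_boot all_order all_algebra.
From mathcomp Require Import finmap.
From mathcomp Require Import all_classical all_reals all_analysis.
From mathcomp Require Import measurable_realfun.
From mathcomp Require Import ring lra.

(** By induction on the level, [M_j + E_j = I] and [E_j] is the accumulated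
    residual operator ([Mop_add_Eop], [Eop_accresid]). The operator [M_n] is
    linear because the [Q_i] are, so the value of [ftilde] at a site [x] is
    [(M_n f) x + (M_n eps) x], and the second term is a fixed linear
    combination of the values of the noise, hence has mean zero
    ([lfun_noise_mean]). So the mean of [ftilde] is [M_n f], and the bias is
    [f - M_n f = E_n f].

    The coefficients of that combination are the row [M_n (delta y) x] of the
    matrix of [M_n]. If the noise has covariance [sigma^2 I], the variance at
    [x] is therefore [sigma^2] times the sum of the squared entries of the row
    ([lfun_noise_sqr_mean]), and summing over [x] gives the squared
    Hilbert-Schmidt norm of [M_n], which is the trace of [M_n M_n^*]
    ([optrace_adjoint]). The mean squared error at [x] is the squared bias plus
    the variance, because the cross term has mean zero
    ([has_mean_bias_variance]).

    All expectations are computed with [has_mean], which carries integrability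
    along with the value. The products of two noise values are integrable
    because the diagonal of the covariance is finite, so that every noise value
    is square-integrable. *)

Set Implicit Arguments.
Unset Strict Implicit.
Unset Printing Implicit Defensive.

Import Order.TTheory GRing.Theory Num.Theory.
Local Open Scope ring_scope.

(* The value at a site, as opposed to the coordinate in a basis of a vector
   space, which has the same name. *)
Local Notation coord := Defs.coord.

Section Operators.
Variables (R : realType) (dim : nat) (X : {fset 'rV[R]_dim}).
Local Notation H := {ffun X -> R^o}.
Implicit Types (u v : H) (A : 'End(H)) (Q : nat -> 'End(H)).

Lemma Mop_add_Eop Q j u : Mop Q j u + Eop Q j u = u.
Proof.
rewrite /Mop /Eop; elim: j => [|j IH] /=.
  by rewrite zero_lfunE add0r id_lfunE.
case: (multiscale Q j) IH => M E /= IH.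
by rewrite !add_lfunE opp_lfunE addrACA subrr addr0.
Qed.

Lemma Eop_accresid Q j : Eop Q j = accresid Q j.
Proof.
rewrite /Eop; elim: j => [//|j IH] /=.
case: (multiscale Q j) IH => M E /= ->.
by rewrite /resid comp_lfunDl comp_lfun1l comp_lfunNl.
Qed.

(** The matrix form of [A], with entries [A (delta y) x]. *)
Lemma lfun_coordE A u x : A u x = \sum_(y : X) A (delta y) x * u y.
Proof.
rewrite [in LHS](delta_sum u) linear_sum sum_ffunE.
by apply: eq_bigr => y _; rewrite linearZ ffunE; exact: mulrC.
Qed.

Lemma hnorm_sqr u : hnorm u ^+ 2 = \sum_(x : X) u x ^+ 2.
Proof.
rewrite /hnorm sqr_sqrtr; first by apply: eq_bigr => x _; rewrite expr2.
by apply: sumr_ge0 => x _; rewrite -expr2 sqr_ge0.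
Qed.

Lemma optraceE A : optrace A = \sum_(x : X) A (delta x) x.
Proof.
rewrite /optrace /mxtrace; under eq_bigr do rewrite mxE.
by rewrite -(big_enum_val (A := {: X}) (fun x => A (delta x) x)).
Qed.

(** The trace of [A A^*] is the squared Hilbert-Schmidt norm of [A]. *)
Lemma optrace_adjoint A :
  optrace (A \o adjoint A)%VF = \sum_(x : X) \sum_(y : X) A (delta y) x ^+ 2.
Proof.
rewrite optraceE; apply: eq_bigr => x _.
rewrite comp_lfunE lfun_coordE; apply: eq_bigr => y _.
(* The adjoint has the transposed matrix. *)
have -> : adjoint A (delta x) y = A (delta y) x.
  by rewrite -[LHS]inner_delta -inner_adjoint /inner; under eq_bigr do
    rewrite mulrC; exact: inner_delta.
by rewrite expr2.
Qed.

End Operators.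

Section Means.
Variables (R : realType) (d : measure_display) (T : measurableType d).
Variable P : probability T R.
Implicit Types (g h : T -> R) (r s : R).

(** [g] is integrable with expectation [r]. Keeping integrability and value
    together makes the notion stable under finite linear combinations. *)
Definition has_mean g r :=
  P.-integrable [set: T] (EFin \o g) /\ 'E_P[g]%E = r%:E.

Lemma has_mean_cst r : has_mean (cst r) r.
Proof.
split; last exact: expectation_cst.
exact: finite_measure_integrable_cst.
Qed.

Lemma has_meanD g h r s :
  has_mean g r -> has_mean h s -> has_mean (fun w => g w + h w) (r + s).
Proof.
move=> [ig Eg] [ih Eh]; split.
  by rewrite (_ : _ \o _ = ((EFin \o g) \+ (EFin \o h))%E) //; exact: integrableD.
by rewrite expectationD ?Eg ?Eh//; exact/Lfun1_integrable.
Qed.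

Lemma has_meanZ k g r : has_mean g r -> has_mean (fun w => k * g w) (k * r).
Proof.
move=> [ig Eg]; split.
  by rewrite (_ : _ \o _ = (fun w => k%:E * (g w)%:E)%E) //; exact: integrableZl.
rewrite (_ : (fun w => _) = k \o* g); last by apply/funext => w /=; rewrite mulrC.
by rewrite expectationZl ?Eg//; exact/Lfun1_integrable.
Qed.

Lemma has_mean_sum (I : Type) (l : seq I) (g : I -> T -> R) (r : I -> R) :
  (forall i, has_mean (g i) (r i)) ->
  has_mean (fun w => \sum_(i <- l) g i w) (\sum_(i <- l) r i).
Proof.
move=> gr; elim: l => [|i l IH].
  rewrite big_nil (_ : (fun w => _) = cst 0); first exact: has_mean_cst.
  by apply/funext => w; rewrite big_nil.
rewrite big_cons (_ : (fun w => _) = (fun w => g i w + \sum_(j <- l) g j w)).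
  exact: has_meanD.
by apply/funext => w; rewrite big_cons.
Qed.

(** A nonnegative measurable function with a finite expectation is
    integrable. *)
Lemma has_mean_ge0 g r : measurable_fun [set: T] g -> (forall w, 0 <= g w) ->
  'E_P[g]%E = r%:E -> has_mean g r.
Proof.
move=> mg g0 Eg; split => //; apply/integrableP; split.
  exact/measurable_EFinP.
under eq_integral do rewrite /= ger0_norm//.
by move: Eg; rewrite unlock => ->; rewrite ltry.
Qed.

(** Square-integrability gives integrability of the product, by
    [|g h| <= g^2 + h^2]. *)
Lemma integrable_mul g h r s :
  measurable_fun [set: T] g -> measurable_fun [set: T] h ->
  has_mean (fun w => g w ^+ 2) r -> has_mean (fun w => h w ^+ 2) s ->
  P.-integrable [set: T] (EFin \o (fun w => g w * h w)).
Proof.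
move=> mg mh g2 h2; have [igh _] := has_meanD g2 h2.
apply: le_integrable igh => //; first exact/measurable_EFinP/measurable_funM.
move=> w _ /=; rewrite lee_fin [leRHS]ger0_norm ?addr_ge0 ?sqr_ge0// normrM.
rewrite -(real_normK (num_real (g w))) -(real_normK (num_real (h w))).
have a0 := normr_ge0 (g w); have b0 := normr_ge0 (h w).
have := sqr_ge0 (`|g w| - `|h w|).
nra.
Qed.

(** Bias-variance decomposition at a point: the cross term has mean zero. *)
Lemma has_mean_bias_variance b g r :
  has_mean g 0 -> has_mean (fun w => g w ^+ 2) r ->
  has_mean (fun w => (b - g w) ^+ 2) (b ^+ 2 + r).
Proof.
move=> g1 g2; have := has_meanD (has_mean_cst (b ^+ 2))
  (has_meanD (has_meanZ (- (2 * b)) g1) g2).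
rewrite mulr0 add0r; congr (has_mean _ _); apply/funext => w /=; ring.
Qed.

End Means.

Section Noise.
Variables (R : realType) (dim : nat) (X : {fset 'rV[R]_dim}).
Variables (d : measure_display) (T : measurableType d) (P : probability T R).
Variable eps : T -> {ffun X -> R^o}.
Hypotheses (eps_rand : random_element eps) (eps_int : integrable_element P eps).
Hypothesis eps_mean : mean P eps = 0.

Lemma noise_mean x : has_mean P (coord eps x) 0.
Proof.
split; first exact: eps_int.
(* [mean] takes the finite part of the expectation, so integrability is needed
   to exclude the infinite values, which [fine] also sends to 0. *)
have /ffunP/(_ x) := eps_mean; rewrite !ffunE => E0.
rewrite -[LHS]fineK ?E0//; apply: expectation_fin_num.
exact/Lfun1_integrable/eps_int.
Qed.

Lemma lfun_noise_mean (A : 'End({ffun X -> R^o})) x :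
  has_mean P (fun w => A (eps w) x) 0.
Proof.
have := has_mean_sum (index_enum X)
  (fun y => has_meanZ (A (delta y) x) (noise_mean y)).
rewrite big1 => [|y _]; last exact: mulr0.
by congr (has_mean _ _ _); apply/funext => w; rewrite [RHS]lfun_coordE.
Qed.

Variable c : R.
Hypothesis eps_cov : has_cov_scalar P eps c.

Lemma noise_cov x y :
  'E_P[fun w => (coord eps x w * coord eps y w)%R]%E = (c * (x == y)%:R)%:E.
Proof.
rewrite -eps_cov covariance.unlock (noise_mean x).2 (noise_mean y).2.
by congr expectation; apply/funext => w; rewrite /= mulrfctE /= !subr0.
Qed.

(** Square-integrability of the noise comes from the diagonal of the
    covariance. *)
Lemma noise_sqr_mean x : has_mean P (fun w => coord eps x w ^+ 2) c.
Proof.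
apply: has_mean_ge0 => [|w|]; last 2 first.
- exact: sqr_ge0.
- by have := noise_cov x x; rewrite eqxx mulr1.
by apply: measurable_funX; exact: eps_rand.
Qed.

Lemma noise_mul_mean x y :
  has_mean P (fun w => coord eps x w * coord eps y w) (c * (x == y)%:R).
Proof.
split; last exact: noise_cov.
exact: integrable_mul (eps_rand x) (eps_rand y)
  (noise_sqr_mean x) (noise_sqr_mean y).
Qed.

(** For noise of covariance [c I], the variance of a linear functional of the
    noise is [c] times the squared Euclidean norm of its coefficients. *)
Lemma lfun_noise_sqr_mean (A : 'End({ffun X -> R^o})) x :
  has_mean P (fun w => A (eps w) x ^+ 2) (c * \sum_(y : X) A (delta y) x ^+ 2).
Proof.
have := has_mean_sum (index_enum X) (fun y => has_mean_sum (index_enum X)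
  (fun z => has_meanZ (A (delta y) x * A (delta z) x) (noise_mul_mean y z))).
congr (has_mean _ _ _).
  apply/funext => w; rewrite lfun_coordE expr2 mulr_suml.
  apply: eq_bigr => y _; rewrite mulr_sumr; apply: eq_bigr => z _.
  exact: mulrACA.
rewrite mulr_sumr; apply: eq_bigr => y _.
rewrite (bigD1 y) //= big1 => [|z zy]; first by rewrite eqxx mulr1 addr0 mulrC.
by rewrite eq_sym (negPf zy) !mulr0.
Qed.

End Noise.

Theorem theorem3p2 (R : realType) (dim : nat) (X : {fset 'rV[R]_dim})
    (n : nat) (Q : nat -> 'End({ffun X -> R^o}))
    (d : measure_display) (T : measurableType d) (P : probability T R)
    (f : {ffun X -> R^o}) (eps Y ftilde : T -> {ffun X -> R^o})
    (eps_rand : random_element eps)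
    (eps_int : integrable_element P eps)
    (eps_mean : mean P eps = 0)
    (YE : forall w, Y w = f + eps w)
    (ftildeE : forall w, ftilde w = Mop Q n (Y w)) :
  [/\ integrable_element P ftilde,
      mean P ftilde = Mop Q n f,
      f - mean P ftilde = Eop Q n f,
      Eop Q n f = accresid Q n f &
      forall x : X,
        (f x - mean P ftilde x) ^+ 2 = (accresid Q n f x) ^+ 2] /\
  (forall sigma : R, has_cov_scalar P eps (sigma ^+ 2) ->
    [/\ IBias2 P f ftilde = hnorm (accresid Q n f) ^+ 2,
        IVar P ftilde =
          (sigma ^+ 2 * optrace (Mop Q n \o adjoint (Mop Q n))%VF)%:E &
        MISE P f ftilde =
          (hnorm (accresid Q n f) ^+ 2
           + sigma ^+ 2 * optrace (Mop Q n \o adjoint (Mop Q n))%VF)%:E]).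
Proof.
have coordE x w : coord ftilde x w = Mop Q n f x + Mop Q n (eps w) x.
  by rewrite /coord ftildeE YE linearD ffunE.
have hm x : has_mean P (coord ftilde x) (Mop Q n f x).
  have := has_meanD (has_mean_cst P (Mop Q n f x))
    (lfun_noise_mean eps_int eps_mean (Mop Q n) x).
  by rewrite addr0; congr (has_mean _ _ _); apply/funext => w; rewrite coordE.
have meanE : mean P ftilde = Mop Q n f.
  by apply/ffunP => x; rewrite ffunE (hm x).2.
have biasE : f - mean P ftilde = accresid Q n f.
  by rewrite meanE -Eop_accresid -{1}(Mop_add_Eop Q n f) addrAC subrr add0r.
have biasxE x : f x - mean P ftilde x = accresid Q n f x.
  by rewrite -biasE !ffunE.
split; first split => //.
- by move=> x; exact: (hm x).1.
- by rewrite Eop_accresid.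
- by rewrite Eop_accresid.
- by move=> x; rewrite biasxE.
move=> sigma eps_cov.
have var x := lfun_noise_sqr_mean eps_rand eps_int eps_mean eps_cov (Mop Q n) x.
split.
- by rewrite hnorm_sqr; apply: eq_bigr => x _; rewrite biasxE.
- rewrite optrace_adjoint mulr_sumr -sumEFin; apply: eq_bigr => x _.
  rewrite -(var x).2; congr expectation; apply/funext => w.
  by rewrite coordE meanE addrAC subrr add0r.
rewrite hnorm_sqr optrace_adjoint mulr_sumr -big_split -sumEFin.
apply: eq_bigr => x _.
rewrite -(has_mean_bias_variance (accresid Q n f x)
  (lfun_noise_mean eps_int eps_mean (Mop Q n) x) (var x)).2.
congr expectation; apply/funext => w.
by rewrite coordE -biasxE meanE opprD addrA.
Qed.
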